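(* Let $\sigma>0$, $\rho>0$, $\alpha>0$, $m=\lceil\alpha\rceil$, $K>0$, $h^*>0$, $b_0,\dots,b_{m-1}\in\mathbb{R}$, and $$ H=\Big\{(t,y)\in\mathbb{R}^2: 0\le t\le h^*,\ \Big|y-e^{-\sigma t^\rho}\sum_{k=0}^{m-1}\frac{b_k}{\Gamma(k+1)}t^{\rho k}\Big|\le K\Big\}. $$ Let $f:H\to\mathbb{R}$ be continuous and bounded, and suppose there is a constant $L>0$ with $|f(t,y)-f(t,\tilde y)|\le L|y-\tilde y|$ for all $(t,y),(t,\tilde y)\in H$. Put $M=\sup_{(x,y)\in H}|f(x,y)|$, let $\tilde h>0$ be a real number with $\tilde h<\big(\frac{\Gamma(\alpha+1)}{L}\big)^{1/(\rho\alpha)}$, and set $$ h=\min\Big\{h^*,\ \tilde h,\ \Big(\frac{\Gamma(\alpha+1)K}{M}\Big)^{1/(\rho\alpha)}\Big\}. $$ Then the Volterra equation $$ \psi(t)=e^{-\sigma t^\rho}\sum_{k=0}^{m-1}\frac{b_k}{\Gamma(k+1)}t^{\rho k}+\frac{\rho}{\Gamma(\alpha)}\int_0^t\frac{e^{-\sigma(t^\rho-s^\rho)}}{(t^\rho-s^\rho)^{1-\alpha}}\,s^{\rho-1}f(s,\psi(s))\,ds,\qquad t\in[0,h], $$ possesses a uniquely determined solution $\psi\in C[0,h]$.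
   Context: A solution $\psi\in C[0,h]$ of the Volterra equation is a continuous function on $[0,h]$ with $(t,\psi(t))\in H$ for all $t\in[0,h]$ (so that $f(t,\psi(t))$ is defined) satisfying the equation for all $t\in[0,h]$. If $M=0$, the third term in the minimum defining $h$ is read as $+\infty$. *)

(* Defs.v *)
From mathcomp Require Export all_boot all_order all_algebra.
From mathcomp Require Export all_classical all_reals all_analysis.
Set Implicit Arguments.
Unset Strict Implicit.
Unset Printing Implicit Defensive.
Export Order.TTheory GRing.Theory Num.Theory.
Export numFieldNormedType.Exports.
Global Open Scope classical_set_scope.
Global Open Scope ring_scope.

(* Euler's integral; it is only ever evaluated at positive x, where it
   converges. *)
Definition Gamma (R : realType) (x : R) : R :=
  \int[lebesgue_measure]_(t in `]0, +oo[) (t `^ (x - 1) * expR (- t)).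

(* t `^ (rho * 0) = 1 also at t = 0, since 0 `^ 0 = 1. *)
Definition free_term (R : realType) (sigma rho : R) (m : nat) (b : 'I_m -> R)
    (t : R) : R :=
  expR (- sigma * t `^ rho) *
  \sum_(k < m) b k / Gamma (k%:R + 1) * t `^ (rho * k%:R).

Definition domainH (R : realType) (sigma rho : R) (m : nat) (b : 'I_m -> R)
    (K hstar : R) : set (R * R) :=
  [set z | 0 <= z.1 <= hstar /\ `|z.2 - free_term sigma rho b z.1| <= K].

(* A real supremum; meaningful when f is bounded on the nonempty set H. *)
Definition sup_abs (R : realType) (H : set (R * R)) (f : R * R -> R) : R :=
  sup [set `|f z| | z in H].

(* When M = 0 the third term of the minimum is read as +oo, i.e. dropped
   (the field inverse of 0 being 0, the formula cannot be used as is). *)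
Definition horizon (R : realType) (rho alpha K hstar htilde M : R) : R :=
  if M == 0 then Num.min hstar htilde
  else Num.min (Num.min hstar htilde)
         ((Gamma (alpha + 1) * K / M) `^ (rho * alpha)^-1).

(* For psi continuous with graph in H and f continuous on H, the integrand is
   Lebesgue integrable on [0, t] (the kernel has at most integrable
   singularities, at s = 0 and s = t), so the real-valued Lebesgue integral is
   a genuine one; the values of the kernel at those endpoints do not matter. *)
Definition volterra_rhs (R : realType) (sigma rho alpha : R) (m : nat)
    (b : 'I_m -> R) (f : R * R -> R) (psi : R -> R) (t : R) : R :=
  free_term sigma rho b t +
  rho / Gamma alpha *
  \int[lebesgue_measure]_(s in `[0, t])
    (expR (- sigma * (t `^ rho - s `^ rho)) /
       (t `^ rho - s `^ rho) `^ (1 - alpha) *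
     s `^ (rho - 1) * f (s, psi s)).

(* An element of C[0, h] is represented by a function on R, of which only the
   restriction to [0, h] is relevant. *)
Definition volterra_solution (R : realType) (sigma rho alpha : R) (m : nat)
    (b : 'I_m -> R) (H : set (R * R)) (f : R * R -> R) (h : R)
    (psi : R -> R) : Prop :=
  [/\ {within `[0, h], continuous psi},
      forall t, t \in `[0, h] -> H (t, psi t) &
      forall t, t \in `[0, h] ->
        psi t = volterra_rhs sigma rho alpha b f psi t].

(* Main.v *)
From mathcomp Require Import measurable_realfun ring lra.
Require Import Defs.
Set Implicit Arguments.
Unset Strict Implicit.
Unset Printing Implicit Defensive.

(** The right-hand side of the Volterra equation is a contraction [Phi] of the
    ball of radius [K] about the free term in [C[0, h]], and its fixed points
    are the solutions.

    Everything rests on the mass of the kernel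
    [kernel t s = (t^rho - s^rho)^(alpha - 1) * s^(rho - 1)].  It has the
    elementary primitive [- (t^rho - s^rho)^alpha / (rho * alpha)], so
    [integral_kernel] gives [t^(rho alpha) / (rho alpha)] for its integral over
    [[0, t]].  The factor [expR (- sigma (t^rho - s^rho))] is at most 1, and
    [rho / Gamma alpha] times this mass is [t^(rho alpha) / Gamma (alpha + 1)]
    by the functional equation [GammaD1].  Hence, with
    [w = h^(rho alpha) / Gamma (alpha + 1)], [Phi psi] stays within [M w <= K]
    of the free term (third term of the horizon), and [Phi] has Lipschitz
    constant [L w < 1] for the sup norm (second term of the horizon).

    The delicate point is the continuity of [Phi psi], since the kernel is
    singular at the moving endpoint [s = t] when [alpha < 1].  The kernels
    attached to [u n --> t] converge pointwise away from [s = t] to the one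
    attached to [t], and their masses converge as well by the explicit formula;
    by Scheffe's lemma ([scheffe]) they then converge in [L^1], whence
    [fracint_cvg] for any bounded measurable integrand.

    The fixed point is the limit of the Picard iterates
    ([contraction_fixpoint]); continuity on [[0, h]] is handled through
    sequences ([within_continuous_cvgn], [cvgn_within_continuous]).

    That [Gamma (alpha + 1)] is positive comes from the existence of a positive
    [htilde] below [(Gamma (alpha + 1) / L)^(1 / (rho alpha))], and the
    positivity of [Gamma alpha] then follows from [GammaD1]. *)

(** * Fundamental theorem of calculus on open intervals *)

(** The segments [[a n, b n]] exhaust [J], on each of them the usual theorem
    applies, and monotone convergence passes to the limit on both sides.  Two
    functions [f] and [g] appear because either integral may a priori be
    infinite, in which case [f - g] could not be integrated directly. *)
Lemma ge0_FTC2_exhaustion (R : realType) (f g F : R -> R) (a b : nat -> R)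
    (la lb : R) (J := \bigcup_n [set` `[a n, b n]]) :
  (forall n, a n < b n) ->
  nonincreasing_seq a -> nondecreasing_seq b ->
  (forall x, J x -> 0 <= f x) -> (forall x, J x -> 0 <= g x) ->
  (forall x, J x -> {for x, continuous f}) ->
  (forall x, J x -> {for x, continuous g}) ->
  (forall x, J x -> is_derive x 1 F (f x - g x)) ->
  F (a n) @[n --> \oo] --> la -> F (b n) @[n --> \oo] --> lb ->
  (\int[@lebesgue_measure R]_(x in J) (f x)%:E =
   \int[@lebesgue_measure R]_(x in J) (g x)%:E + (lb - la)%:E)%E.
Proof.
move=> ab na nb f0 g0 cf cg dF Fa Fb.
have subJ n x : a n <= x <= b n -> J x by move=> xn; exists n => //=; rewrite in_itv.
have wc (u : R -> R) n : (forall x, J x -> {for x, continuous u}) ->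
    {within [set` `[a n, b n]], continuous u}.
  move=> cu; apply: continuous_in_subspaceT => x; rewrite inE /= in_itv /=.
  by move=> /subJ; exact: cu.
have ci (u : R -> R) : (forall x, J x -> 0 <= u x) ->
    (forall x, J x -> {for x, continuous u}) ->
    (\int[@lebesgue_measure R]_(x in [set` `[a n, b n]]) (u x)%:E
      @[n --> \oo] --> \int[@lebesgue_measure R]_(x in J) (u x)%:E)%E.
  move=> u0 cu; apply: ge0_nondecreasing_set_cvg_integral => //.
  - apply/nondecreasing_seqP => n; rewrite subsetEset => x /=.
    rewrite !in_itv /= => /andP[ax xb].
    by rewrite (le_trans _ ax) ?na//= (le_trans xb)// nb.
  - move=> n; apply/measurable_EFinP; apply: subspace_continuous_measurable_fun => //.
    exact: wc.
  - by move=> n x nx; rewrite lee_fin u0//; exists n.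
have ii (u : R -> R) n : (forall x, J x -> {for x, continuous u}) ->
    (@lebesgue_measure R).-integrable `[a n, b n] (EFin \o u).
  move=> cu; apply: continuous_compact_integrable; first exact: segment_compact.
  exact: wc.
have key n : (\int[@lebesgue_measure R]_(x in [set` `[a n, b n]]) (f x)%:E =
    \int[@lebesgue_measure R]_(x in [set` `[a n, b n]]) (g x)%:E
    + (F (b n) - F (a n))%:E)%E.
  have cfg x : J x -> {for x, continuous (fun x => f x - g x)}.
    by move=> Jx; apply: cvgB; [exact: cf|exact: cg].
  have cF x : J x -> {for x, continuous F}.
    by move=> /dF [d _]; apply: differentiable_continuous; apply/derivable1_diffP.
  rewrite EFinB.
  rewrite -(@continuous_FTC2 _ (fun x => f x - g x) F)//; last 3 first.
  - exact: wc.
  - split.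
    + by move=> x; rewrite in_itv/= => /andP[/ltW ax /ltW xb]; have [] := dF x (subJ n x _); rewrite ?ax.
    + by apply: cvg_at_right_filter; apply: cF; apply: (subJ n); rewrite lexx ltW.
    + by apply: cvg_at_left_filter; apply: cF; apply: (subJ n); rewrite lexx ltW.
  - move=> x; rewrite in_itv/= => /andP[/ltW ax /ltW xb].
    have [|_ <-] := dF x (subJ n x _); first by rewrite ax.
    by rewrite derive1E.
  under [X in _ = (_ + X)%E]eq_integral do rewrite EFinB.
  rewrite integralB_EFin//; try exact: ii.
  by rewrite addeC subeK// integrable_fin_num//; exact: ii.
have := ci f f0 cf; under eq_cvg do rewrite key.
move=> /cvg_unique; apply => //.
apply: cvgeD.
- exact: fin_num_adde_defl.
- exact: ci.
- by apply: cvg_EFin; [exact: nearW|exact: cvgB].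
Qed.

(** * Functional equation of the Gamma function *)

Lemma powR_expRN_derive (R : realType) (a x : R) : 0 < x ->
  is_derive x 1 (fun t : R => t `^ a * expR (- t))
    (a * x `^ (a - 1) * expR (- x) - x `^ a * expR (- x)).
Proof.
move=> x0.
have dp := is_derive1_powR a x0.
have de : is_derive x 1 (fun t : R => expR (- t)) (- expR (- x)).
  have := is_derive1_comp (is_derive_expR (- x)) (is_deriveNid x (1 : R)).
  by congr is_derive; rewrite /GRing.scale /=; ring.
have := is_deriveM dp de; rewrite /GRing.scale /=.
by congr is_derive; ring.
Qed.

(** If [a <= k], then [t^a <= t^k] for [t >= 1], while [expR t] dominates
    [t^(k+1) / (k+1)!]. *)
Lemma powR_expRN_cvgn (R : realType) (a : R) :
  (fun n => n.+2%:R `^ a * expR (- n.+2%:R) : R) @ \oo --> 0.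
Proof.
have [k ak] : exists k : nat, a <= k%:R.
  by exists (Num.truncn `|a|).+1; rewrite (le_trans (ler_norm _))// ltW// truncnS_gt.
apply: (@squeeze_cvgr _ _ _ _ (fun=> 0) (fun n => (k.+1)`!%:R * (n.+1%:R)^-1)).
- near=> n; rewrite mulr_ge0 ?powR_ge0 ?expR_ge0//=.
  set t : R := n.+2%:R.
  have t0 : 0 < t by rewrite ltr0n.
  have t1 : 1 <= t by rewrite ler1n.
  have e1 : t ^+ k.+1 / k.+1`!%:R <= expR t.
    by rewrite (le_trans _ (expR_ge1Dxn k (ltW t0)))// lerDr.
  have f0 : 0 < k.+1`!%:R :> R by rewrite ltr0n fact_gt0.
  rewrite expRN ler_pdivrMr ?expR_gt0//.
  apply: (@le_trans _ _ (t ^+ k)).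
    by rewrite -powR_mulrn ?(ltW t0)// ler_powR.
  apply: le_trans (ler_wpM2l _ e1); last by rewrite mulr_ge0 ?invr_ge0.
  rewrite [leRHS](_ : _ = t ^+ k * (t / n.+1%:R)); last first.
    have n0 : 0 < n.+1%:R :> R by rewrite ltr0n.
    rewrite exprS; move: f0 n0; move: (_`!%:R : R) (n.+1%:R : R) => c d c0 d0.
    by field; rewrite !gt_eqF.
  by rewrite ler_peMr ?exprn_ge0 ?(ltW t0)// ler_pdivlMr// mul1r ler_nat.
- exact: cvg_cst.
- rewrite -[X in _ --> X](mulr0 (k.+1)`!%:R).
  by apply: cvgMr; exact: cvg_harmonic.
Unshelve. all: by end_near. Qed.

(** The offset 2 keeps the first segment, [[1/2, 2]], nondegenerate. *)
Lemma itv0y_bigcup (R : realType) :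
  [set` `]0, +oo[] = \bigcup_n [set` `[n.+2%:R^-1, n.+2%:R]] :> set R.
Proof.
apply/seteqP; split=> x /=; rewrite in_itv/=; last first.
  move=> [n _] /=; rewrite in_itv/= => /andP[nx _].
  by rewrite andbT (lt_le_trans _ nx)// invr_gt0.
rewrite andbT => x0; exists (Num.truncn (x + x^-1)) => //=.
have xt : x + x^-1 < (Num.truncn (x + x^-1)).+2%:R.
  by rewrite (lt_trans (truncnS_gt _))// ltr_nat.
have V0 : 0 < x^-1 by rewrite invr_gt0.
rewrite in_itv/=; apply/andP; split.
  by rewrite -[leRHS]invrK lef_pV2 ?posrE//; lra.
by lra.
Qed.

(** Integration by parts: [t^a expR (- t)] vanishes at both ends of the half
    line and its derivative is the difference of the two integrands.  The
    equality holds between extended reals, so no convergence has to be shown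
    beforehand. *)
Lemma GammaD1 (R : realType) (a : R) : 0 < a -> Gamma (a + 1) = a * Gamma a.
Proof.
move=> a0; rewrite /Gamma /Rintegral addrK.
pose p (t : R) := t `^ a * expR (- t).
pose f (t : R) := a * (t `^ (a - 1) * expR (- t)).
have J0 (x : R) : (\bigcup_n [set` `[n.+2%:R^-1, n.+2%:R]]) x -> 0 < x.
  by rewrite -itv0y_bigcup /= in_itv/= andbT.
have cp r (x : R) : 0 < x -> {for x, continuous (fun t : R => t `^ r * expR (- t))}.
  move=> /(powR_expRN_derive r) [d _].
  by apply: differentiable_continuous; apply/derivable1_diffP.
have key : (\int[@lebesgue_measure R]_(x in [set` `]0%R, +oo[]) (f x)%:E =
   \int[@lebesgue_measure R]_(x in [set` `]0%R, +oo[]) (p x)%:E)%E.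
  rewrite itv0y_bigcup.
  rewrite -[RHS]adde0 -[X in (_ + X%:E)%E](subrr (0 : R)).
  apply: (@ge0_FTC2_exhaustion _ f p p (fun n => n.+2%:R^-1) (fun n => n.+2%:R)).
  - by move=> n; rewrite (@lt_trans _ _ 1)// ?invf_lt1 ?ltr1n ?ltr0n.
  - apply/nonincreasing_seqP => n.
    by rewrite lef_pV2 ?posrE ?ltr0n// ler_nat.
  - by apply/nondecreasing_seqP => n; rewrite ler_nat.
  - by move=> x /J0 x0; rewrite !mulr_ge0 ?powR_ge0 ?expR_ge0// ltW.
  - by move=> x /J0 x0; rewrite !mulr_ge0 ?powR_ge0 ?expR_ge0// ltW.
  - by move=> x /J0 x0; apply: cvgMr; exact: cp.
  - by move=> x /J0 x0; exact: cp.
  - move=> x /J0 x0; have := powR_expRN_derive a x0.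
    by rewrite /f mulrA.
  - apply: (@squeeze_cvgr _ _ _ _ (fun=> 0) (fun n => (n.+2%:R^-1) `^ a)).
    + near=> n; rewrite /p mulr_ge0 ?powR_ge0 ?expR_ge0//=.
      by rewrite ler_piMr ?powR_ge0// -expR0 ler_expR oppr_le0.
    + exact: cvg_cst.
    + have c : ((fun n => n.+2%:R^-1 : R) @ \oo --> 0).
        by have := @cvg_harmonic R; rewrite -(cvg_shiftn 1); under eq_fun do rewrite addn1.
      have : n.+2%:R^-1 @[n --> \oo] --> (0:R)^'+.
        move=> A [e /= e0 eA]; have /cvgrPdist_lt/(_ _ e0) := c.
        by apply: filterS => n nA; apply: eA => //=; rewrite invr_gt0.
      by move=> c'; apply: (@cvg_comp _ _ _ _ (fun x => x `^ a) _ _ _ c' (powR_cvg0 a0)).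
  - exact: powR_expRN_cvgn.
rewrite -[in LHS]/p -key.
pose q (t : R) := t `^ (a - 1) * expR (- t).
have q0 x : (0 <= (q x)%:E)%E by rewrite lee_fin mulr_ge0 ?powR_ge0 ?expR_ge0.
have mq : measurable_fun ([set` `]0%R, +oo[] : set R) q.
  apply: open_continuous_measurable_fun; first exact: interval_open.
  by move=> x; rewrite inE/= in_itv/= andbT; exact: cp.
have -> : (\int[@lebesgue_measure R]_(x in [set` `]0%R, +oo[]) (f x)%:E =
   a%:E * \int[@lebesgue_measure R]_(x in [set` `]0%R, +oo[]) (q x)%:E)%E.
  rewrite -ge0_integralZl_EFin ?(ltW a0)//.
  exact/measurable_EFinP.
have : (0 <= \int[@lebesgue_measure R]_(x in [set` `]0%R, +oo[]) (q x)%:E)%E.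
  by apply: integral_ge0 => x _; exact: q0.
(* a divergent integral is read as 0 on both sides *)
case: (integral _ _ _) => [r _||]//=.
by rewrite mulry gtr0_sg// mul1e /= mulr0.
Unshelve. all: by end_near. Qed.

(** * Mass of the singular kernel *)

Lemma continuous_powR_pos (R : realType) (r x : R) : 0 < x ->
  {for x, continuous (fun y : R => y `^ r)}.
Proof.
move=> x0; apply: differentiable_continuous; apply/derivable1_diffP.
by apply: derivable_powR; rewrite in_itv/= x0.
Qed.

(** The cut-off at 0 is essential: a negative number raised to any power is 1
    by convention. *)
Lemma continuous_powR_max0 (R : realType) (r : R) : 0 < r ->
  continuous (fun x : R => Num.max 0 x `^ r).
Proof.
move=> r0 x; rewrite /continuous_at; have [x0|x0|<-] := ltgtP 0 x.
- apply: (@cvg_trans _ (y `^ r @[y --> x])); last first.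
    exact: continuous_powR_pos.
  apply: near_eq_cvg; near=> y; rewrite (max_idPr _)// ltW//.
  by near: y; exact: lt_nbhsr.
- apply/cvgrPdist_lt => e e0; near=> y.
  rewrite (max_idPl _) ?subrr ?normr0// ltW//.
  by near: y; exact: lt_nbhsl.
- rewrite powR0 ?gt_eqF//.
  apply/cvgrPdist_lt => e e0; near=> y.
  rewrite sub0r normrN ger0_norm ?powR_ge0//.
  rewrite -[ltRHS](powRr1 (ltW e0)) -(mulVf (lt0r_neq0 r0)) powRrM.
  rewrite gt0_ltr_powR ?nnegrE ?powR_ge0// ?le_max ?lexx//.
  rewrite gt_max powR_gt0//=; near: y; apply: lt_nbhsl; exact: powR_gt0.
Unshelve. all: by end_near. Qed.

Lemma cvg_powR (R : realType) (T : Type) (F : set_system T) (r l : R)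
    (f : T -> R) : Filter F -> 0 < r -> 0 <= l -> (\forall x \near F, 0 <= f x) ->
  f @ F --> l -> f x `^ r @[x --> F] --> l `^ r.
Proof.
move=> FF r0 l0 f0 fl.
have := @cvg_comp _ _ _ f (fun x => Num.max 0 x `^ r) _ _ _ fl (@continuous_powR_max0 R r r0 l).
rewrite (max_idPr l0); apply: cvg_trans; apply: near_eq_cvg.
by apply: filterS f0 => x fx /=; rewrite (max_idPr fx).
Qed.

(** The exponent [alpha - 1] is written as the inverse of the power
    [1 - alpha], the form in which the equation is stated. *)
Definition kernel (R : realType) (rho alpha t s : R) : R :=
  ((t `^ rho - s `^ rho) `^ (1 - alpha))^-1 * s `^ (rho - 1).

Lemma kernel_ge0 (R : realType) (rho alpha t s : R) : 0 <= kernel rho alpha t s.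
Proof. by rewrite mulr_ge0 ?invr_ge0 ?powR_ge0. Qed.

Lemma measurable_kernel (R : realType) (rho alpha t : R) (D : set R) :
  measurable_fun D (kernel rho alpha t).
Proof.
apply: measurable_funTS; rewrite /kernel.
under eq_fun do rewrite -powRN.
apply: measurable_funM; last exact: measurable_powR.
apply: (measurableT_comp (measurable_powR _)).
by apply: measurable_funB => //; exact: measurable_powR.
Qed.

Lemma ltr_powR_pos (R : realType) (rho s t : R) : 0 < rho -> 0 <= s -> s < t ->
  s `^ rho < t `^ rho.
Proof.
by move=> r0 s0 st; rewrite gt0_ltr_powR ?nnegrE// (le_trans s0)// ltW.
Qed.

Lemma continuous_kernel (R : realType) (rho alpha t s : R) :
  0 < rho -> 0 < s -> s < t -> {for s, continuous (kernel rho alpha t)}.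
Proof.
move=> r0 s0 st; rewrite /kernel; apply: cvgM; last exact: continuous_powR_pos.
have d0 : 0 < t `^ rho - s `^ rho by rewrite subr_gt0 ltr_powR_pos// ltW.
apply: cvgV; first by rewrite gt_eqF// powR_gt0.
apply: (@cvg_comp _ _ _ _ (fun x => x `^ (1 - alpha))).
  by apply: cvgB; [exact: cvg_cst|apply: continuous_powR_pos].
exact: continuous_powR_pos.
Qed.

(** The offset 3 keeps the first segment, [[t/3, 2t/3]], nondegenerate. *)
Lemma itv0t_bigcup (R : realType) (t : R) : 0 < t ->
  [set` `]0, t[] = \bigcup_n [set` `[t / n.+3%:R, t - t / n.+3%:R]] :> set R.
Proof.
move=> t0; apply/seteqP; split=> x /=; rewrite in_itv/=; last first.
  move=> [n _] /=; rewrite in_itv/= => /andP[nx xn].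
  have n0 : 0 < t / n.+3%:R by rewrite divr_gt0.
  by rewrite (lt_le_trans n0 nx)/= (le_lt_trans xn)// ltrBlDr ltrDl.
move=> /andP[x0 xt]; pose y := t / x + t / (t - x).
have tx0 : 0 < t - x by rewrite subr_gt0.
have A0 : 0 < t / x by rewrite divr_gt0.
have B0 : 0 < t / (t - x) by rewrite divr_gt0.
exists (Num.truncn y) => //=.
have : y < (Num.truncn y).+3%:R.
  by rewrite (lt_trans (truncnS_gt _))// ltr_nat.
rewrite /y; set N := _.+3%:R => yN.
have N0 : 0 < N by rewrite ltr0n.
rewrite in_itv/= lerBrDl -lerBrDr; apply/andP; split.
  by rewrite ler_pdivrMr// mulrC -ler_pdivrMr//; lra.
by rewrite ler_pdivrMr// mulrC -ler_pdivrMr//; lra.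
Qed.

Lemma harmonic3_cvg (R : realType) (t : R) : t / n.+3%:R @[n --> \oo] --> (0 : R).
Proof.
rewrite -[X in _ --> X](mulr0 t); apply: cvgMr.
have := @cvg_harmonic R; rewrite -(cvg_shiftn 2).
by under eq_fun do rewrite addn2.
Qed.

Lemma is_derive_kernel_primitive (R : realType) (rho alpha t s : R) :
  0 < rho -> 0 < alpha -> 0 < s -> s < t ->
  is_derive s 1 (fun x => - (t `^ rho - x `^ rho) `^ alpha / (rho * alpha))
    (kernel rho alpha t s).
Proof.
move=> r0 a0 s0 st.
have d0 : 0 < t `^ rho - s `^ rho by rewrite subr_gt0 ltr_powR_pos// ltW.
have dr := is_derive1_powR rho s0.
have dB : is_derive s 1 (fun x => t `^ rho - x `^ rho) (- (rho * s `^ (rho - 1))).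
  by have := is_deriveB (is_derive_cst (t `^ rho) s 1) dr; rewrite sub0r.
have dp := is_derive1_powR alpha d0.
have dc := @is_derive1_comp _ (fun y => y `^ alpha) (fun x => t `^ rho - x `^ rho) s _ _ dp dB.
rewrite (_ : (fun x => _) = - (rho * alpha)^-1 \*:
    ((fun y => y `^ alpha) \o (fun x => t `^ rho - x `^ rho))); last first.
  by apply/funext => x /=; rewrite /GRing.scale /= mulNr mulNr mulrC.
apply: (is_derive_eq (is_deriveZ (- (rho * alpha)^-1) dc)).
rewrite /kernel -powRN opprB /GRing.scale /=.
by field; rewrite !gt_eqF.
Qed.

(** Valid for every [alpha > 0], although the integrand may be singular at
    both ends: the primitive extends continuously to [[0, t]]. *)
Lemma integral_kernel (R : realType) (rho alpha t : R) :
  0 < rho -> 0 < alpha -> 0 <= t ->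
  (\int[@lebesgue_measure R]_(s in [set` `[0%R, t]]) (kernel rho alpha t s)%:E =
   (t `^ (rho * alpha) / (rho * alpha))%:E)%E.
Proof.
move=> r0 a0; rewrite le_eqVlt => /predU1P[<-|t0].
  by rewrite set_itv1 integral_set1 powR0 ?mul0r// mulf_neq0 ?gt_eqF.
have ck x : ([set` `]0, t[] : set R) x -> {for x, continuous (kernel rho alpha t)}.
  by rewrite /= in_itv/= => /andP[x0 xt]; exact: continuous_kernel.
have mk D : measurable_fun D (fun x => (kernel rho alpha t x)%:E).
  by apply/measurable_EFinP; exact: measurable_kernel.
rewrite -integral_itv_bndo_bndc//.
rewrite -integral_itv_obnd_cbnd//.
have J0 (x : R) : (\bigcup_n [set` `[t / n.+3%:R, t - t / n.+3%:R]]) x -> 0 < x < t.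
  by rewrite -itv0t_bigcup//= in_itv.
have Fcvg (u : nat -> R) (x : R) : 0 <= x -> (\forall n \near \oo, 0 <= u n <= t) ->
    u @ \oo --> x ->
    - (t `^ rho - u n `^ rho) `^ alpha / (rho * alpha) @[n --> \oo] -->
    - (t `^ rho - x `^ rho) `^ alpha / (rho * alpha).
  move=> x0 u0t ux.
  have ut : x <= t.
    apply: (closed_cvg (fun y => y <= t)) ux; [exact: closed_le|].
    by apply: filterS u0t => n /andP[].
  apply: cvgMl; apply: cvgN; apply: cvg_powR => //.
  - by rewrite subr_ge0 ge0_ler_powR ?nnegrE ?(ltW r0) ?(ltW t0).
  - apply: filterS u0t => n /andP[un unt].
    by rewrite subr_ge0 ge0_ler_powR ?nnegrE ?(ltW r0) ?(ltW t0).
  - apply: cvgB; first exact: cvg_cst.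
    by apply: cvg_powR => //; apply: filterS u0t => n /andP[].
rewrite itv0t_bigcup// -[RHS]add0e.
rewrite -[X in (X + _)%E](integral0 (@lebesgue_measure R) (\bigcup_n [set` `[t / n.+3%:R, t - t / n.+3%:R]])).
rewrite -[X in (_ + X%:E)%E]opprK -[X in (_ + X%:E)%E]sub0r -mulNr.
apply: (@ge0_FTC2_exhaustion _ (kernel rho alpha t) (fun=> 0)
  (fun x => - (t `^ rho - x `^ rho) `^ alpha / (rho * alpha))
  (fun n => t / n.+3%:R) (fun n => t - t / n.+3%:R)).
- move=> n; rewrite ltrBrDr -mulrDl ltr_pdivrMr ?ltr0n// -mulr2n -(mulr_natr t 2).
  by rewrite ltr_pM2l// ltr_nat.
- apply/nonincreasing_seqP => n.
  by rewrite ler_wpM2l ?(ltW t0)// lef_pV2 ?posrE ?ltr0n// ler_nat.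
- apply/nondecreasing_seqP => n; rewrite lerB//.
  by rewrite ler_wpM2l ?(ltW t0)// lef_pV2 ?posrE ?ltr0n// ler_nat.
- by move=> x _; exact: kernel_ge0.
- by [].
- by move=> x /J0 x0; apply: ck; rewrite /= in_itv.
- by move=> x _; exact: cvg_cst.
- by move=> x /J0/andP[x0 xt]; rewrite subr0; exact: is_derive_kernel_primitive.
- rewrite powRrM -[X in - X `^ _](subr0) -[X in _ - X](powR0 (lt0r_neq0 r0)).
  apply: Fcvg => //.
  + by near=> n; rewrite divr_ge0 ?(ltW t0)//= ler_piMr ?(ltW t0)// invf_le1 ?ler1n ?ltr0n.
  + exact: harmonic3_cvg.
- rewrite [X in _ --> X](_ : _ = - (t `^ rho - t `^ rho) `^ alpha / (rho * alpha)); last first.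
    by rewrite subrr powR0 ?gt_eqF// oppr0 mul0r.
  apply: Fcvg; [exact: ltW| |].
  + near=> n; rewrite lerBlDr lerDl divr_ge0 ?(ltW t0)// andbT subr_ge0.
    by rewrite ler_piMr ?(ltW t0)// invf_le1 ?ler1n ?ltr0n.
  + rewrite -[X in _ --> X]subr0; apply: cvgB; first exact: cvg_cst.
    exact: harmonic3_cvg.
Unshelve. all: by end_near. Qed.

(** * Continuity of weakly singular integrals *)

(** With [v n] the positive part of [g - g_ n], one has
    [|g_ n - g| = 2 v n + (g_ n - g)].  The [v n] are dominated by [g], so
    their integrals tend to 0, and the rest tends to 0 by hypothesis. *)
Lemma scheffe d (T : measurableType d) (R : realType)
    (mu : {measure set T -> \bar R}) (D : set T) (g_ : nat -> T -> R) (g : T -> R) :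
  measurable D ->
  (forall n, mu.-integrable D (EFin \o g_ n)) -> mu.-integrable D (EFin \o g) ->
  (forall n x, D x -> 0 <= g_ n x) -> (forall x, D x -> 0 <= g x) ->
  {ae mu, forall x, D x -> g_ n x @[n --> \oo] --> g x} ->
  \int[mu]_(x in D) g_ n x @[n --> \oo] --> \int[mu]_(x in D) g x ->
  \int[mu]_(x in D) `|g_ n x - g x| @[n --> \oo] --> (0 : R).
Proof.
move=> mD ig_ ig g0_ g0 gg Igg.
pose v n x := Num.max 0 (g x - g_ n x).
have mg_ n : measurable_fun D (g_ n) by apply/measurable_EFinP; exact: measurable_int (ig_ n).
have mg : measurable_fun D g by apply/measurable_EFinP; exact: measurable_int ig.
have mv n : measurable_fun D (EFin \o v n).
  apply/measurable_EFinP; apply: measurable_maxr; first exact: measurable_cst.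
  exact: measurable_funB.
have vg n x : D x -> (`|(v n x)%:E| <= (g x)%:E)%E.
  move=> Dx; rewrite lee_fin ger0_norm ?le_max ?lexx//.
  by rewrite ge_max g0//= lerBlDr lerDl g0_.
have iv n : mu.-integrable D (EFin \o v n).
  apply: (le_integrable mD (mv n) _ ig) => x Dx /=.
  by apply: (le_trans (vg n x Dx)); rewrite lee_fin ler_norm.
have Iv : \int[mu]_(x in D) v n x @[n --> \oo] --> (0 : R).
  have [] // := @dominated_convergence _ T R mu D mD (fun n => EFin \o v n) (cst 0%E) (EFin \o g) mv.
  - move: gg; apply: filterS => x + Dx => /(_ Dx) gx.
    apply: cvg_EFin; first exact: nearW.
    apply/cvgrPdist_lt => e e0; move/cvgrPdist_lt : gx => /(_ _ e0).
    apply: filterS => n; rewrite sub0r normrN => ge.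
    rewrite ger0_norm ?le_max ?lexx// gt_max e0/=.
    exact: le_lt_trans (ler_norm _) ge.
  - by apply: aeW => x n Dx; exact: vg.
  - by move=> _ _; rewrite integral0 => /fine_cvg.
rewrite [X in X @ _ --> _](_ : _ = fun n => 2 * \int[mu]_(x in D) v n x +
    (\int[mu]_(x in D) g_ n x - \int[mu]_(x in D) g x)); last first.
  apply/funext => n.
  have igB : mu.-integrable D (EFin \o (fun x => g_ n x - g x)).
    by have := integrableB mD (ig_ n) ig.
  have i2v : mu.-integrable D (EFin \o (fun x => 2 * v n x)).
    by have := integrableZl mD 2 (iv n).
  rewrite -RintegralB// -RintegralZl// -RintegralD//.
  apply: eq_Rintegral => x _; rewrite /v.
  by case: (leP 0 (g x - g_ n x)) => H; [rewrite ler0_norm|rewrite gtr0_norm]; lra.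
rewrite -[X in _ --> X](addr0 0) -[X in _ --> X + _](mulr0 2).
rewrite -[X in _ --> _ + X](subrr (\int[mu]_(x in D) g x)).
by apply: cvgD; [exact: cvgMr|apply: cvgB => //; exact: cvg_cst].
Qed.

Lemma cvg_kernel (R : realType) (rho alpha s t : R) (u : nat -> R) :
  0 < rho -> 0 <= s -> s < t -> (forall n, 0 <= u n) -> u @ \oo --> t ->
  kernel rho alpha (u n) s @[n --> \oo] --> kernel rho alpha t s.
Proof.
move=> r0 s0 st u0 ut; have t0 : 0 < t by exact: le_lt_trans st.
have d0 : 0 < t `^ rho - s `^ rho by rewrite subr_gt0 ltr_powR_pos.
apply: cvgMl; apply: cvgV; first by rewrite gt_eqF// powR_gt0.
apply: (@cvg_comp _ _ _ (fun n => u n `^ rho - s `^ rho) (fun x => x `^ (1 - alpha))).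
  apply: cvgB; last exact: cvg_cst.
  by apply: (@cvg_powR _ _ _ _ t) => //; [exact: ltW|exact: nearW].
exact: continuous_powR_pos.
Qed.

Section weighted_integral.
Context (R : realType) (sigma rho alpha h : R).
Context (sigma0 : 0 <= sigma) (rho0 : 0 < rho) (alpha0 : 0 < alpha).
Implicit Types (s t C : R) (y z : R -> R).
Notation mu := (@lebesgue_measure R).

Local Notation I t := ([set` `[0%R, t]] : set R).

Let mI t : measurable (I t : set (measurableTypeR R)).
Proof. exact: measurable_itv. Qed.

Lemma integrable_kernel t : 0 <= t ->
  mu.-integrable (I t) (EFin \o kernel rho alpha t).
Proof.
move=> t0; apply/integrableP; split.
  by apply/measurable_EFinP; exact: measurable_kernel.
under eq_integral do rewrite /= ger0_norm ?kernel_ge0//.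
by rewrite integral_kernel// ltry.
Qed.

Lemma Rintegral_kernel t : 0 <= t ->
  \int[mu]_(s in I t) kernel rho alpha t s = t `^ (rho * alpha) / (rho * alpha).
Proof. by move=> t0; rewrite /Rintegral integral_kernel. Qed.

Definition damped_kernel t s :=
  expR (- sigma * (t `^ rho - s `^ rho)) / (t `^ rho - s `^ rho) `^ (1 - alpha) *
  s `^ (rho - 1).

(** Up to the factor [rho / Gamma alpha], the tempered fractional integral of
    order [alpha] and rate [sigma] with respect to the variable [s^rho]. *)
Definition fracint (y : R -> R) t := \int[mu]_(s in I t) (damped_kernel t s * y s).

(** The damping splits into a factor depending on [t] alone and one that can be
    absorbed in the integrand; what remains is a kernel of known mass. *)
Lemma damped_kernelE t s :
  damped_kernel t s =
  expR (- sigma * t `^ rho) * (kernel rho alpha t s * expR (sigma * s `^ rho)).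
Proof.
rewrite /damped_kernel /kernel.
rewrite (_ : - sigma * _ = - sigma * t `^ rho + sigma * s `^ rho); last by ring.
by rewrite expRD -!mulrA; congr (_ * _); rewrite mulrC -mulrA.
Qed.

Lemma damped_kernel_ge0 t s : 0 <= damped_kernel t s.
Proof. by rewrite !mulr_ge0 ?invr_ge0 ?powR_ge0 ?expR_ge0. Qed.

Lemma damped_kernel_le t s : I t s -> damped_kernel t s <= kernel rho alpha t s.
Proof.
rewrite /= in_itv /= => /andP[s0 st].
rewrite /damped_kernel -mulrA ler_piMl ?kernel_ge0// -expR0 ler_expR.
rewrite mulNr oppr_le0 mulr_ge0// subr_ge0.
by rewrite ge0_ler_powR ?nnegrE ?(ltW rho0) ?(le_trans s0).
Qed.

Lemma measurable_damped_kernel t (D : set R) : measurable_fun D (damped_kernel t).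
Proof.
rewrite (_ : damped_kernel t = fun s => expR (- sigma * t `^ rho) *
    (kernel rho alpha t s * expR (sigma * s `^ rho))); last first.
  by apply/funext => s; rewrite damped_kernelE.
apply: measurable_funM; first exact: measurable_cst.
apply: measurable_funM; first exact: measurable_kernel.
apply: measurableT_comp => //.
apply: measurable_funM; first exact: measurable_cst.
by apply: measurable_funTS; exact: measurable_powR.
Qed.

Lemma integrable_damped_kernelM t (y : R -> R) C : 0 <= t ->
  measurable_fun (I t) y -> (forall s, I t s -> `|y s| <= C) ->
  mu.-integrable (I t) (EFin \o (fun s => damped_kernel t s * y s)).
Proof.
move=> t0 my yC.
apply: (le_integrable _ _ _ (integrableZl _ C (integrable_kernel t0))) => //.
  apply/measurable_EFinP; apply: measurable_funM => //.
  exact: measurable_damped_kernel.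
move=> s sI /=; rewrite lee_fin normrM (ger0_norm (damped_kernel_ge0 _ _)).
rewrite (le_trans _ (ler_norm _))// mulrC.
by rewrite ler_pM ?damped_kernel_ge0 ?yC ?damped_kernel_le.
Qed.

Lemma fracint_le t (y : R -> R) C : 0 <= t ->
  measurable_fun (I t) y -> (forall s, I t s -> `|y s| <= C) ->
  `|fracint y t| <= C * (t `^ (rho * alpha) / (rho * alpha)).
Proof.
move=> t0 my yC; have iy := integrable_damped_kernelM t0 my yC.
rewrite (le_trans (le_normr_Rintegral (mI _) iy))//.
rewrite -Rintegral_kernel// -RintegralZl//; last exact: integrable_kernel.
apply: le_Rintegral => //.
- by have := integrable_norm iy.
- by have := integrableZl (mI _) C (integrable_kernel t0).
- move=> s sI; rewrite normrM (ger0_norm (damped_kernel_ge0 _ _)) mulrC.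
  by rewrite ler_pM ?damped_kernel_ge0 ?yC ?damped_kernel_le.
Qed.

Lemma fracintB t (y z : R -> R) C : 0 <= t ->
  measurable_fun (I t) y -> (forall s, I t s -> `|y s| <= C) ->
  measurable_fun (I t) z -> (forall s, I t s -> `|z s| <= C) ->
  fracint y t - fracint z t = fracint (fun s => y s - z s) t.
Proof.
move=> t0 my yC mz zC; rewrite /fracint -RintegralB//; last 2 first.
- exact: integrable_damped_kernelM yC.
- exact: integrable_damped_kernelM zC.
by apply: eq_Rintegral => s _; rewrite mulrBr.
Qed.

(** Extending the kernels by 0 makes them functions on the fixed interval
    [[0, h]], which is what passing to the limit in [t] requires. *)
Let W t : R -> R := kernel rho alpha t \_ (I t).

Let W_ge0 t s : 0 <= W t s.
Proof. by rewrite /W patchE; case: ifPn => // _; exact: kernel_ge0. Qed.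

Let Isub t : t <= h -> I t `<=` I h.
Proof.
by move=> th s; rewrite /= !in_itv /= => /andP[-> /le_trans]; apply.
Qed.

Let Wint t : 0 <= t <= h -> mu.-integrable (I h) (EFin \o W t).
Proof.
move=> /andP[t0 th]; rewrite /W -restrict_EFin.
apply/integrable_restrict => //.
by rewrite setIidr; [exact: integrable_kernel|exact: Isub].
Qed.

Let IntW t : 0 <= t <= h ->
  \int[mu]_(s in I h) W t s = t `^ (rho * alpha) / (rho * alpha).
Proof.
move=> /andP[t0 th]; rewrite -Rintegral_kernel//.
by rewrite /W -Rintegral_mkcondr setIidr//; exact: Isub.
Qed.

Let W_cvg t (u : nat -> R) : (forall n, 0 <= u n) -> u @ \oo --> t ->
  {ae mu, forall s, I h s -> W (u n) s @[n --> \oo] --> W t s}.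
Proof.
move=> u0 ut; exists [set t]; split => //; first exact: lebesgue_measure_set1.
move=> s; apply: contra_notP => /eqP st /=; rewrite /= in_itv /= => /andP[s0 sh].
move: st; rewrite neq_lt => /orP[st|ts].
  rewrite [X in _ --> X](_ : _ = kernel rho alpha t s); last first.
    by rewrite /W patchE ifT// inE /= in_itv/= s0 ltW.
  apply: cvg_trans (cvg_kernel (alpha := alpha) rho0 s0 st u0 ut).
  apply: near_eq_cvg; near=> n.
  rewrite /W patchE ifT//.
  rewrite inE /= in_itv/= s0 ltW//.
  by near: n; apply: (cvgr_gt _ ut).
have W0 r : r < s -> W r s = 0.
  move=> rs; rewrite /W patchE ifN// notin_setE /= in_itv/= s0/=.
  by apply/negP; rewrite -ltNge.
rewrite (W0 _ ts); apply/cvgrPdist_lt => e e0; near=> n.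
rewrite W0 ?subrr ?normr0//.
by near: n; apply: (cvgr_lt _ ut).
Unshelve. all: by end_near. Qed.

(** Once the damping is absorbed in the integrand by [damped_kernelE], the
    difference of two integrals is at most the bound on the integrand times the
    [L^1] distance of the kernels, to which [scheffe] applies. *)
Lemma fracint_cvg (y : R -> R) C t (u : nat -> R) :
  measurable_fun (I h) y -> (forall s, I h s -> `|y s| <= C) ->
  0 <= t <= h -> (forall n, 0 <= u n <= h) -> u @ \oo --> t ->
  fracint y (u n) @[n --> \oo] --> fracint y t.
Proof.
move=> my yC th uh ut.
have u0 n : 0 <= u n by have /andP[] := uh n.
have /andP[t0 _] := th.
have rho_alpha0 : 0 < rho * alpha by rewrite mulr_gt0.
pose z s := expR (sigma * s `^ rho) * y s.
pose B := expR (sigma * h `^ rho) * C.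
have mz : measurable_fun (I h) z.
  apply: measurable_funM => //; apply: measurableT_comp => //.
  apply: measurable_funM; first exact: measurable_cst.
  by apply: measurable_funTS; exact: measurable_powR.
have zB s : I h s -> `|z s| <= B.
  move=> hs; rewrite normrM ger0_norm ?expR_ge0// ler_pM ?expR_ge0 ?yC//.
  move: hs; rewrite /= in_itv/= => /andP[s0 sh].
  by rewrite ler_expR ler_wpM2l// ge0_ler_powR ?nnegrE ?(ltW rho0) ?(le_trans s0).
have iz x : 0 <= x <= h -> mu.-integrable (I h) (EFin \o (fun s => W x s * z s)).
  move=> xh; apply: (le_integrable _ _ _ (integrableZl _ B (Wint xh))) => //.
    apply/measurable_EFinP; apply: measurable_funM => //.
    by apply/measurable_EFinP; exact: measurable_int (Wint xh).
  move=> s hs /=; rewrite lee_fin normrM (ger0_norm (W_ge0 _ _)).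
  by rewrite (le_trans _ (ler_norm _))// mulrC ler_wpM2r ?W_ge0 ?zB.
have E x : 0 <= x <= h -> fracint y x =
    expR (- sigma * x `^ rho) * \int[mu]_(s in I h) (W x s * z s).
  move=> xh; rewrite -RintegralZl//; last exact: iz.
  have /andP[x0 xh'] := xh.
  rewrite /fracint -(setIidr (Isub xh')) Rintegral_mkcondr.
  apply: eq_Rintegral => s _; rewrite /W !patchE.
  case: ifPn => _; last by rewrite mul0r mulr0.
  by rewrite damped_kernelE /z !mulrA.
rewrite E//; under eq_fun do rewrite E//.
apply: cvgM.
  apply: (@cvg_comp _ _ _ (fun n => - sigma * u n `^ rho) (@expR R)); last exact: continuous_expR.
  by apply: cvgMr; apply: (@cvg_powR _ _ _ _ t) => //; exact: nearW.
have IWu l : l = t `^ (rho * alpha) / (rho * alpha) ->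
    \int[mu]_(s in I h) W (u n) s @[n --> \oo] --> l.
  move=> ->; have -> : (fun n => \int[mu]_(s in I h) W (u n) s) =
      (fun n => u n `^ (rho * alpha) / (rho * alpha)).
    by apply/funext => n; exact: IntW.
  by apply: cvgMl; apply: (@cvg_powR _ _ _ _ t) => //; exact: nearW.
have sch := scheffe (mI _) (fun n => Wint (uh n)) (Wint th)
  (fun n x _ => W_ge0 (u n) x) (fun x _ => W_ge0 t x) (W_cvg u0 ut)
  (IWu _ (IntW th)).
apply/subr_cvg0.
apply/norm_cvg0P.
apply: (@squeeze_cvgr _ _ _ _ (fun=> 0)
  (fun n => B * \int[mu]_(x in I h) `|W (u n) x - W t x|)).
- near=> n; rewrite normr_ge0 /=.
  have iD : mu.-integrable (I h) (EFin \o (fun x => `|W (u n) x - W t x|)).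
    by have := integrable_norm (integrableB (mI _) (Wint (uh n)) (Wint th)).
  have izD : mu.-integrable (I h) (EFin \o (fun x => W (u n) x * z x - W t x * z x)).
    by have := integrableB (mI _) (iz _ (uh n)) (iz _ th).
  rewrite -RintegralB//; [|exact: iz|exact: iz].
  rewrite (le_trans (le_normr_Rintegral (mI _) izD))// -RintegralZl//.
  apply: le_Rintegral => //.
  + by have := integrable_norm izD.
  + by have := integrableZl (mI _) B iD.
  + by move=> s sI; rewrite -mulrBl normrM mulrC ler_wpM2r ?zB.
- exact: cvg_cst.
- by rewrite -[X in _ --> X](mulr0 B); apply: cvgMr.
Unshelve. all: by end_near. Qed.

End weighted_integral.

(** * Continuity on a segment through sequences *)

Lemma within_continuous_cvgn (T V : topologicalType) (A : set T) (f : T -> V)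
    (u : nat -> T) (t : T) :
  {within A, continuous f} -> A t -> (forall n, A (u n)) -> u @ \oo --> t ->
  f (u n) @[n --> \oo] --> f t.
Proof.
move=> /subspace_continuousP fA At Au ut.
apply: (@cvg_comp _ _ _ u f _ (within A (nbhs t))); last exact: fA.
move=> P nP; have utP : \forall n \near \oo, A (u n) -> P (u n) by exact: (ut [set x | A x -> P x] nP).
change (\forall n \near \oo, P (u n)).
by apply: filterS utP => n /(_ (Au n)).
Qed.

(** Composing with the retraction of the line onto [[0, h]] reduces continuity
    within the segment to plain sequential continuity on the line. *)
Lemma cvgn_within_continuous (R : realType) (h : R) (F : R -> R) : 0 <= h ->
  (forall t (u : nat -> R), 0 <= t <= h -> (forall n, 0 <= u n <= h) ->
    u @ \oo --> t -> F (u n) @[n --> \oo] --> F t) ->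
  {within `[0, h], continuous F}.
Proof.
move=> h0 seqF; pose c (x : R) := Num.max 0 (Num.min x h).
have c0h x : 0 <= c x <= h by rewrite le_max lexx ge_max h0 ge_min lexx orbT.
have cE : {in ([set` `[0, h]] : set R), F \o c =1 F}.
  move=> x; rewrite inE /= in_itv/= => /andP[x0 xh].
  by rewrite /c (min_idPl xh) (max_idPr x0).
apply: (subspace_eq_continuous cE); apply: continuous_subspaceT => x.
have cc : continuous c.
  move=> y; apply: (@continuous_max R R (fun=> 0) (fun x => Num.min x h)).
    exact: cvg_cst.
  apply: (@continuous_min R R id (fun=> h)); first exact: cvg_id.
  exact: cvg_cst.
apply/(@cvg_nbhsP _ R^o) => u ux; apply: seqF => //.
by apply: (cvg_comp _ _ ux); exact: cc.
Qed.

(** * Uniform contractions on sets of functions *)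

(** Banach's theorem for a set [S] of functions that is closed under uniform
    convergence on [D] and has diameter at most [B] there.  Members of
    [S] are compared on [D] only, so [S] need not be a metric space and
    uniqueness is up to equality on [D].  Iterating [Phi] n times brings any two members
    of [S] within [q^n B] of each other on [D]: comparing iterates of [phi0]
    and of [iter k Phi phi0] yields the Cauchy property. *)
Lemma contraction_fixpoint (T : Type) (R : realType) (D : set T)
    (S : set (T -> R)) (Phi : (T -> R) -> T -> R) (q B : R) (phi0 : T -> R) :
  0 <= q < 1 -> S phi0 -> (forall psi, S psi -> S (Phi psi)) ->
  (forall psi phi, S psi -> S phi -> forall t, D t -> `|psi t - phi t| <= B) ->
  (forall psi phi (d : R), S psi -> S phi ->
    (forall t, D t -> `|psi t - phi t| <= d) ->
    forall t, D t -> `|Phi psi t - Phi phi t| <= q * d) ->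
  (forall (g : nat -> T -> R) psi, (forall n, S (g n)) ->
    (forall e : R, 0 < e -> \forall n \near \oo, forall t, D t -> `|g n t - psi t| <= e) ->
    S psi) ->
  exists psi, [/\ S psi, forall t, D t -> psi t = Phi psi t &
    forall phi, S phi -> (forall t, D t -> phi t = Phi phi t) ->
      forall t, D t -> phi t = psi t].
Proof.
move=> /andP[q0 q1] S0 SPhi SB Sq Sclosed.
have qB : q ^+ n * B @[n --> \oo] --> (0 : R).
  rewrite -[X in _ --> X](mul0r B); apply: cvgMl; apply: cvg_expr.
  by rewrite ger0_norm.
have eq0 (x : R) : (forall n, `|x| <= q ^+ n * B) -> x = 0.
  move=> xB; apply/normr0_eq0/eqP; rewrite eq_le normr_ge0 andbT.
  by apply: (cvgr_to_ge qB); apply: nearW => n; exact: xB.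
have iterS n psi : S psi -> S (iter n Phi psi).
  by move=> Spsi; elim: n => //= n; exact: SPhi.
have iterB n psi phi : S psi -> S phi -> forall t, D t ->
    `|iter n Phi psi t - iter n Phi phi t| <= q ^+ n * B.
  move=> Spsi Sphi; elim: n => [|n IH] t Dt; first by rewrite mul1r SB.
  by rewrite exprS -mulrA; apply: Sq => //; exact: iterS.
pose g n := iter n Phi phi0.
have gB n k t : D t -> `|g n t - g (n + k)%N t| <= q ^+ n * B.
  by move=> Dt; rewrite /g iterD iterB//; exact: iterS.
have gcvg t : D t -> cvgn (g ^~ t).
  move=> Dt; apply/cauchy_cvgP/cauchyP => e e0.
  have /cvgrPdist_lt/(_ _ e0)[N _ HN] := qB.
  exists (g N t); exists N => //= n /= /subnKC <-.
  apply: le_lt_trans (gB _ _ _ Dt) _.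
  have := HN N (leqnn _); rewrite /= sub0r normrN.
  exact: le_lt_trans (ler_norm _).
pose psi t : R := limn (g ^~ t).
have gpsi n t : D t -> `|g n t - psi t| <= q ^+ n * B.
  move=> Dt.
  have : `|g n t - g k t| @[k --> \oo] --> `|g n t - psi t|.
    by apply: cvg_norm; apply: cvgB; [exact: cvg_cst|exact: gcvg].
  move=> c; apply: (cvgr_to_le c); exists n => //= k /= nk.
  by rewrite -(subnKC nk); exact: gB.
have Spsi : S psi.
  apply: (Sclosed g) => [n|e e0]; first exact: iterS.
  have /cvgrPdist_lt/(_ _ e0) := qB; apply: filterS => n; rewrite sub0r normrN => ne t Dt.
  apply: le_trans (gpsi _ _ Dt) _.
  exact/ltW/(le_lt_trans (ler_norm _)).
have fixpsi t : D t -> psi t = Phi psi t.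
  move=> Dt; apply/eqP; rewrite -subr_eq0; apply/eqP.
  have c : (1 + 1) * (q * (q ^+ n * B)) @[n --> \oo] --> (0 : R).
    rewrite [X in _ --> X](_ : 0 = (1 + 1) * (q * 0)); last by rewrite !mulr0.
    by do 2 apply: cvgMr.
  apply/normr0_eq0/eqP; rewrite eq_le normr_ge0 andbT.
  apply: (cvgr_to_ge c); apply: nearW => n.
  rewrite (_ : psi t - _ = (psi t - g n.+1 t) + (Phi (g n) t - Phi psi t)); last first.
    by rewrite /g /=; ring.
  rewrite (le_trans (ler_normD _ _))// mulrDl mul1r lerD//.
    by rewrite distrC mulrA -exprS gpsi.
  by apply: Sq => //; [exact: iterS|move=> s Ds; exact: gpsi].
exists psi; split=> // phi Sphi fixphi t Dt.
apply/eqP; rewrite -subr_eq0; apply/eqP/eq0 => n.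
elim: n t Dt => [|n IH] t Dt; first by rewrite mul1r SB.
by rewrite fixphi// fixpsi// exprS -mulrA; exact: Sq.
Qed.

(** * The Volterra equation *)

(** The summand of index 0 is treated apart: its exponent is 0, whereas
    [cvg_powR] requires a positive one. *)
Lemma cvg_free_term (R : realType) (sigma rho : R) (m : nat) (b : 'I_m -> R)
    (t : R) (u : nat -> R) :
  0 < rho -> 0 <= t -> (forall n, 0 <= u n) -> u @ \oo --> t ->
  free_term sigma rho b (u n) @[n --> \oo] --> free_term sigma rho b t.
Proof.
move=> r0 t0 u0 ut; rewrite /free_term; apply: cvgM.
  apply: (@cvg_comp _ _ _ (fun n => - sigma * u n `^ rho) (@expR R)); last exact: continuous_expR.
  by apply: cvgMr; apply: (@cvg_powR _ _ _ _ t) => //; exact: nearW.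
apply: cvg_big => [|k _]; first exact: add_continuous.
apply: cvgMr.
have [->|k0] := eqVneq (k : nat) 0%N.
  by rewrite mulr0; under eq_fun do rewrite powRr0; rewrite powRr0; exact: cvg_cst.
apply: (@cvg_powR _ _ _ _ t) => //; last exact: nearW.
by rewrite mulr_gt0// ltr0n lt0n.
Qed.

Lemma Gamma_ge0 (R : realType) (x : R) : 0 <= Gamma x.
Proof. by apply: Rintegral_ge0 => s _; rewrite mulr_ge0 ?powR_ge0 ?expR_ge0. Qed.

Lemma sup_abs_ge (R : realType) (H : set (R * R)) (f : R * R -> R) (z : R * R) :
  [bounded f z | z in H] -> H z -> `|f z| <= sup_abs H f.
Proof.
move=> /pinfty_ex_gt0[A A0 fA] Hz; apply: ub_le_sup; last by exists z.
by exists A => _ [w Hw <-]; exact: fA.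
Qed.

Lemma powR_lt_root (R : realType) (h a r : R) : 0 <= h -> 0 <= a -> 0 < r ->
  h < a `^ r^-1 -> h `^ r < a.
Proof.
move=> h0 a0 r0 ha; rewrite -[ltRHS](powRr1 a0) -(mulVf (lt0r_neq0 r0)) powRrM.
by rewrite gt0_ltr_powR ?nnegrE ?powR_ge0.
Qed.

Lemma powR_le_root (R : realType) (h a r : R) : 0 <= h -> 0 <= a -> 0 < r ->
  h <= a `^ r^-1 -> h `^ r <= a.
Proof.
move=> h0 a0 r0 ha; rewrite -[leRHS](powRr1 a0) -(mulVf (lt0r_neq0 r0)) powRrM.
by rewrite ge0_ler_powR ?nnegrE ?powR_ge0// ltW.
Qed.

Theorem theorem10 (R : realType) (sigma rho alpha : R)
    (hsigma : 0 < sigma) (hrho : 0 < rho) (halpha : 0 < alpha)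
    (m : nat) (hm : m%:Z = Num.ceil alpha)
    (K hstar : R) (hK : 0 < K) (hhstar : 0 < hstar)
    (b : 'I_m -> R) (f : R * R -> R)
    (hfcont : {within domainH sigma rho b K hstar, continuous f})
    (hfbnd : [bounded f z | z in domainH sigma rho b K hstar])
    (L : R) (hL : 0 < L)
    (hfLip : forall t y y' : R,
      domainH sigma rho b K hstar (t, y) ->
      domainH sigma rho b K hstar (t, y') ->
      `|f (t, y) - f (t, y')| <= L * `|y - y'|)
    (M : R) (hM : M = sup_abs (domainH sigma rho b K hstar) f)
    (htilde : R) (htilde_gt0 : 0 < htilde)
    (htilde_lt : htilde < (Gamma (alpha + 1) / L) `^ (rho * alpha)^-1)
    (h : R) (hh : h = horizon rho alpha K hstar htilde M) :
  exists psi : R -> R,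
    volterra_solution sigma rho alpha b (domainH sigma rho b K hstar) f h psi /\
    forall phi : R -> R,
      volterra_solution sigma rho alpha b (domainH sigma rho b K hstar) f h phi ->
      forall t, t \in `[0, h] -> phi t = psi t.
Proof.
set H := domainH sigma rho b K hstar in hfcont hfbnd hfLip hM *.
have ra0 : 0 < rho * alpha by rewrite mulr_gt0.
(* were [Gamma (alpha + 1)] zero, the upper bound on [htilde] would be zero *)
have G1gt0 : 0 < Gamma (alpha + 1) :> R.
  rewrite lt_neqAle Gamma_ge0 andbT; apply/eqP => G0; move: htilde_lt.
  by rewrite -G0 mul0r powR0 ?invr_eq0 ?gt_eqF// ltNge (ltW htilde_gt0).
have G_gt0 : 0 < Gamma alpha :> R.
  by move: G1gt0; rewrite GammaD1// pmulr_rgt0.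
have HM z : H z -> `|f z| <= M by rewrite hM; exact: sup_abs_ge.
have M_ge0 : 0 <= M.
  apply: le_trans (HM (0, free_term sigma rho b 0) _) => //.
  by rewrite /H /domainH /= lexx subrr normr0 !ltW.
have [h_ge0 h_hstar h_htilde] : [/\ 0 <= h, h <= hstar & h <= htilde].
  by rewrite hh /horizon; case: eqP => _; split;
    rewrite ?le_min ?powR_ge0 ?(ltW hhstar) ?(ltW htilde_gt0) ?ge_min ?lexx ?orbT.
have hhh : 0 <= h <= h by rewrite h_ge0 lexx.
(* [w t] is the total weight of the normalised kernel on [[0, t]] *)
have [w [wE w_le q_lt1 wMK]] : exists w : R -> R,
    [/\ forall t, rho / Gamma alpha * (t `^ (rho * alpha) / (rho * alpha)) = w t,
        forall t, 0 <= t <= h -> 0 <= w t <= w h, L * w h < 1 & w h * M <= K].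
  exists (fun t => t `^ (rho * alpha) / Gamma (alpha + 1)); split=> [t|t /andP[t0 th]||].
  - by rewrite GammaD1//; field; rewrite !gt_eqF.
  - rewrite divr_ge0 ?powR_ge0 ?(ltW G1gt0)//= ler_pM2r ?invr_gt0//.
    by rewrite ge0_ler_powR ?nnegrE// ltW.
  - rewrite mulrA ltr_pdivrMr// mul1r mulrC -ltr_pdivlMr//.
    apply: powR_lt_root => //; last exact: le_lt_trans htilde_lt.
    by rewrite ltW// divr_gt0.
  - have [->|M0] := eqVneq M 0; first by rewrite mulr0 ltW.
    have Mgt0 : 0 < M by rewrite lt_neqAle eq_sym M0.
    rewrite mulrAC ler_pdivrMr// -ler_pdivlMr// [K * _]mulrC.
    apply: powR_le_root => //; first by rewrite ltW// divr_gt0// mulr_gt0.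
    by rewrite hh /horizon (negbTE M0) ge_min lexx orbT.
pose S : set (R -> R) := [set psi | {within `[0, h], continuous psi} /\
  forall t, 0 <= t <= h -> `|psi t - free_term sigma rho b t| <= K].
have SH psi t : S psi -> 0 <= t <= h -> H (t, psi t).
  move=> [_ psiK] th; split => /=; last exact: psiK.
  by have /andP[-> /le_trans ->] := th.
pose y (psi : R -> R) s := f (s, psi s).
have y_cont psi : S psi -> {within `[0, h], continuous (y psi)}.
  move=> Spsi; apply: cvgn_within_continuous => // t u th uh ut.
  apply: (within_continuous_cvgn (u := fun n => (u n, psi (u n))) (t := (t, psi t)) hfcont).
  - exact: (SH psi t Spsi th).
  - by move=> n; exact: (SH psi (u n) Spsi (uh n)).
  - have psiu : psi (u n) @[n --> \oo] --> psi t.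
      by apply: (within_continuous_cvgn Spsi.1) => //=.
    exact: (cvg_pair ut psiu).
have sub_itv t : 0 <= t <= h -> [set` `[0, t]] `<=` ([set` `[0, h]] : set R).
  move=> /andP[_ th] s; rewrite /= !in_itv/= => /andP[-> st].
  exact: le_trans th.
have y_meas psi t : S psi -> 0 <= t <= h -> measurable_fun ([set` `[0, t]] : set R) (y psi).
  move=> Spsi th; apply: (@measurable_funS _ _ _ _ [set` `[0, h]]) => //.
    exact: sub_itv.
  by apply: subspace_continuous_measurable_fun => //; exact: y_cont.
have y_le psi t : S psi -> 0 <= t <= h ->
    forall s, ([set` `[0, t]] : set R) s -> `|y psi s| <= M.
  by move=> Spsi th s /(sub_itv _ th); rewrite /= in_itv => sh; exact/HM/SH.
pose Phi (psi : R -> R) t := volterra_rhs sigma rho alpha b f psi t.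
have PhiE psi t : Phi psi t = free_term sigma rho b t +
  rho / Gamma alpha * fracint sigma rho alpha (y psi) t by [].
have c_ge0 : 0 <= rho / Gamma alpha by rewrite ltW// divr_gt0.
have SPhi psi : S psi -> S (Phi psi).
  move=> Spsi; split.
    apply: cvgn_within_continuous => // t u th uh ut.
    under eq_fun do rewrite PhiE.
    rewrite PhiE; apply: cvgD.
      by apply: cvg_free_term => //; [case/andP: th|move=> n; case/andP: (uh n)].
    apply: cvgMr.
    exact: (fracint_cvg (ltW hsigma) hrho halpha (y_meas _ _ Spsi hhh)
      (y_le _ _ Spsi hhh) th uh ut).
  move=> t th; have /andP[t0 _] := th.
  rewrite PhiE addrAC subrr add0r normrM ger0_norm//.
  apply: le_trans (ler_wpM2l c_ge0 (fracint_le (ltW hsigma) hrho halpha t0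
    (y_meas _ _ Spsi th) (y_le _ _ Spsi th))) _.
  rewrite mulrCA wE mulrC; apply: le_trans wMK; rewrite ler_wpM2r//.
  by have /andP[] := w_le _ th.
have Ssub psi phi (d : R) : S psi -> S phi ->
    (forall t, 0 <= t <= h -> `|psi t - phi t| <= d) ->
    forall t, 0 <= t <= h -> `|Phi psi t - Phi phi t| <= L * w h * d.
  move=> Spsi Sphi psiphi t th; have /andP[t0 _] := th.
  have d0 : 0 <= d by apply: le_trans (psiphi _ th).
  rewrite !PhiE opprD addrACA subrr add0r -mulrBr normrM ger0_norm//.
  rewrite (fracintB (ltW hsigma) hrho halpha t0 (y_meas _ _ Spsi th)
    (y_le _ _ Spsi th) (y_meas _ _ Sphi th) (y_le _ _ Sphi th)).
  apply: (@le_trans _ _ (rho / Gamma alpha *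
      (L * d * (t `^ (rho * alpha) / (rho * alpha))))).
    apply: ler_wpM2l => //; apply: fracint_le => //; first exact: ltW.
    - by apply: measurable_funB; exact: y_meas.
    - move=> s /(sub_itv _ th); rewrite /= in_itv => sh.
      apply: le_trans (hfLip _ _ _ (SH _ _ Spsi sh) (SH _ _ Sphi sh)) _.
      by rewrite ler_pM2l// psiphi.
  rewrite mulrCA wE mulrAC ler_wpM2r// ler_pM2l//.
  by have /andP[] := w_le _ th.
have S_free : S (free_term sigma rho b).
  split; last by move=> t _; rewrite subrr normr0 ltW.
  apply: cvgn_within_continuous => // t u th uh ut.
  by apply: cvg_free_term => //; [case/andP: th|move=> n; case/andP: (uh n)].
have S_diam psi phi : S psi -> S phi ->
    forall t, 0 <= t <= h -> `|psi t - phi t| <= K + K.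
  move=> [_ psiK] [_ phiK] t th.
  rewrite (le_trans (ler_distD (free_term sigma rho b t) _ _))// lerD ?psiK//.
  by rewrite distrC phiK.
have S_closed (g : nat -> R -> R) psi : (forall n, S (g n)) ->
    (forall e : R, 0 < e ->
      \forall n \near \oo, forall t, 0 <= t <= h -> `|g n t - psi t| <= e) ->
    S psi.
  move=> Sg gpsi; split.
    apply: cvgn_within_continuous => // t u th uh ut.
    apply/cvgrPdist_le => e e0.
    have e30 : 0 < e / 3 by rewrite divr_gt0.
    have [N _ /(_ _ (leqnn N)) gN] := gpsi _ e30.
    have gu : g N (u n) @[n --> \oo] --> g N t.
      by apply: (within_continuous_cvgn (Sg N).1) => //=.
    move/cvgrPdist_le : gu => /(_ _ e30); apply: filterS => n gnt.
    rewrite (_ : psi t - psi (u n) = - (g N t - psi t) + (g N t - g N (u n))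
      + (g N (u n) - psi (u n))); last by ring.
    rewrite (_ : e = e / 3 + e / 3 + e / 3); last by field.
    rewrite (le_trans (ler_normD _ _))// lerD//; last exact: gN (uh n).
    by rewrite (le_trans (ler_normD _ _))// lerD// normrN gN.
  move=> t th; apply/ler_addgt0Pl => e e0.
  have [N _ /(_ _ (leqnn N)) /(_ _ th) gN] := gpsi _ e0.
  rewrite (le_trans (ler_distD (g N t) _ _))// lerD//; first by rewrite distrC.
  exact: (Sg N).2.
have q01 : 0 <= L * w h < 1.
  by rewrite q_lt1 andbT mulr_ge0 ?(ltW hL)//; have /andP[] := w_le _ hhh.
have [psi [Spsi psi_fix psi_uniq]] := @contraction_fixpoint R R
  [set t | 0 <= t <= h] S Phi (L * w h) (K + K) _ q01 S_free SPhi S_diam Ssub S_closed.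
exists psi; split.
  split; first exact: Spsi.1.
  - by move=> t; rewrite in_itv; exact: SH.
  - by move=> t; rewrite in_itv; exact: psi_fix.
move=> phi [phi_cont phiH phi_fix] t; rewrite in_itv; apply: psi_uniq.
  by split => // s sh; have [] := phiH s _; rewrite ?in_itv.
by move=> s /= sh; apply: phi_fix; rewrite in_itv.
Qed.
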